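(* For every graph $G$ with maximum degree $\Delta(G)$, $$\mathrm{tw}(L(G)) \leq \tfrac{2}{3}(\mathrm{tw}(G)+1)\Delta(G) + \tfrac{1}{3}\mathrm{tw}(G)^2 + \tfrac{1}{3}\Delta(G) - 1,$$ and $$\mathrm{pw}(L(G)) \leq \tfrac{1}{2}(\mathrm{pw}(G)+1)\Delta(G) + \tfrac{1}{2}\mathrm{pw}(G)^2 + \tfrac{1}{2}\Delta(G) - 1.$$
   Context: Graphs are finite, simple and undirected, and $G$ has at least one vertex. The line graph $L(G)$ has vertex set $E(G)$, two distinct elements being adjacent if and only if the corresponding edges of $G$ share an endpoint. A tree decomposition of a graph $H$ is a (nonempty) tree $T$ together with a collection of subsets of $V(H)$ (bags) indexed by the nodes of $T$ such that: every vertex of $H$ is in at least one bag; for each vertex $v$ of $H$, the nodes whose bags contain $v$ induce a connected subtree of $T$; and for each edge of $H$ some bag contains both its endpoints. Its width is the size of the largest bag minus 1. The treewidth $\mathrm{tw}(H)$ is the minimum width of a tree decomposition of $H$; the pathwidth $\mathrm{pw}(H)$ is the minimum width over tree decompositions whose tree $T$ is a path. (If $H$ has no vertices, $\mathrm{tw}(H)=\mathrm{pw}(H)=-1$.) *)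

(* Defs.v *)
From mathcomp Require Import all_boot all_order all_algebra.
From mathcomp Require Import boolp.

Set Implicit Arguments.
Unset Strict Implicit.
Unset Printing Implicit Defensive.

Record sgraph := SGraph {
  vertex :> finType;
  adj : rel vertex;
  adj_sym : symmetric adj;
  adj_irrefl : irreflexive adj }.

Definition neighbors (G : sgraph) (x : G) : {set G} := [set y | adj x y].

Definition max_degree (G : sgraph) : nat := \max_(x : G) #|neighbors x|.

Definition edges (G : sgraph) : {set {set G}} :=
  [set A | [exists x : G, exists y : G, adj x y && (A == [set x; y])]].

Definition line_vertex (G : sgraph) : finType := {A : {set G} | A \in edges G}.

Definition line_adj (G : sgraph) : rel (line_vertex G) :=
  fun A B => (A != B) && (val A :&: val B != set0).

Lemma line_adj_sym (G : sgraph) : symmetric (@line_adj G).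
Proof. by move=> A B; rewrite /line_adj eq_sym setIC. Qed.

Lemma line_adj_irrefl (G : sgraph) : irreflexive (@line_adj G).
Proof. by move=> A; rewrite /line_adj eqxx. Qed.

Definition line_graph (G : sgraph) : sgraph :=
  SGraph (@line_adj_sym G) (@line_adj_irrefl G).

(* The subgraph of G induced by S is connected (true when S is empty). *)
Definition connected_in (G : sgraph) (S : {set G}) : Prop :=
  {in S &, forall x y,
     connect [rel u v | [&& u \in S, v \in S & adj u v]] x y}.

(* Closed walks u, v, u of length 2 satisfy [ucycle], hence the bound 2. *)
Definition acyclic (G : sgraph) : Prop :=
  forall c : seq G, ucycle (@adj G) c -> (size c <= 2)%N.

Definition is_tree (G : sgraph) : Prop :=
  [/\ (0 < #|G|)%N, connected_in [set: G] & acyclic G].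

Definition is_path (G : sgraph) : Prop :=
  exists (n : nat) (f : 'I_n -> G), bijective f /\
    forall i j : 'I_n, adj (f i) (f j) = (i.+1 == j :> nat) || (j.+1 == i :> nat).

Record tree_decomposition (H T : sgraph) (bag : T -> {set H}) : Prop :=
  TreeDecomposition {
    td_tree : is_tree T;
    td_vertex : forall v : H, exists t : T, v \in bag t;
    td_connected : forall v : H, connected_in [set t : T | v \in bag t];
    td_edge : forall u v : H, adj u v ->
      exists t : T, (u \in bag t) && (v \in bag t) }.

Definition largest_bag (H T : sgraph) (bag : T -> {set H}) : nat :=
  \max_(t : T) #|bag t|.

Definition td_size (H : sgraph) (k : nat) : Prop :=
  exists (T : sgraph) (bag : T -> {set H}),
    tree_decomposition bag /\ largest_bag bag = k.

Definition pd_size (H : sgraph) (k : nat) : Prop :=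
  exists (T : sgraph) (bag : T -> {set H}),
    [/\ tree_decomposition bag, is_path T & largest_bag bag = k].

Lemma pd_size_card (H : sgraph) : pd_size H #|H|.
Proof.
pose e : rel unit := fun _ _ => false.
have es : symmetric e by [].
have ei : irreflexive e by [].
exists (SGraph es ei), (fun=> [set: H]); split.
- split=> [|v|v [] []|u v _].
  + split; first by rewrite card_unit.
      by move=> [] [] _ _; exact: connect0.
    by move=> [|[] [|[] [|z c]]].
  + by exists tt; rewrite inE.
  + by move=> _ _; exact: connect0.
  + by exists tt; rewrite !inE.
- exists 1%N, (fun=> tt); split; first by exists (fun=> ord0) => [i|[]]; rewrite ?ord1.
  by move=> i j; rewrite !ord1.
- rewrite /largest_bag; apply/eqP; rewrite eqn_leq; apply/andP; split.
    by apply/bigmax_leqP => t _; rewrite cardsT.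
  by rewrite -cardsT; apply: (leq_bigmax (tt : SGraph es ei)).
Qed.

Lemma td_size_ex (H : sgraph) : exists k, `[< td_size H k >].
Proof.
have [T [bag [td _ Hk]]] := pd_size_card H.
by exists #|H|; apply/asboolP; exists T, bag.
Qed.

Lemma pd_size_ex (H : sgraph) : exists k, `[< pd_size H k >].
Proof. by exists #|H|; apply/asboolP; exact: pd_size_card. Qed.

(* Both widths are integers, equal to -1 exactly when H has no vertices. *)
Definition treewidth (H : sgraph) : int :=
  ((ex_minn (td_size_ex H))%:Z - 1)%R.

Definition pathwidth (H : sgraph) : int :=
  ((ex_minn (pd_size_ex H))%:Z - 1)%R.

(* Main.v *)
Require Import Defs.
From mathcomp Require Import all_boot all_order all_algebra.
From mathcomp Require Import boolp zify lra.

(* Root a decomposition tree T so that every node has at most d children (d = 2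
   for trees, d = 1 for paths). Give each vertex v a base node b(v) among the
   nodes whose bags contain v, and put the edge vw of G into the bags of all nodes
   on the tree path from b(v) to b(w); edges sharing v then meet at b(v). If b(v)
   is a balanced node for the neighbours of v, at most d/(d+1) of them lie beyond
   any other node x. Replacing each node of T by a path of copies makes the
   b(v) pairwise distinct, so at most one v0 in the bag B of x has b(v0) = x.
   The edges on a path through x are then: at most Delta edges at v0; for each
   other vertex of B at most d/(d+1) Delta edges leaving B; and edges inside
   B \ v0 whose ends are based in different components of T - x, of which there
   are at most (d/(2(d+1))) (|B| - 1)^2 because there are at most d + 1 components. *)

Set Implicit Arguments.
Unset Strict Implicit.
Unset Printing Implicit Defensive.

Import Order.TTheory GRing.Theory Num.Theory.

(** * Rooted trees and the ancestor order *)

(** The root is its own parent. [height] is any function that drops along [par], not necessarily the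
    distance to the root; it forces the iterates of [par] to reach the root. *)
Record rtree := RTree {
  node :> finType;
  par : node -> node;
  troot : node;
  height : node -> nat;
  par_root : par troot = troot;
  height_par : forall x, x != troot -> height (par x) < height x }.

Arguments par {r}.
Arguments troot {r}.
Arguments height {r}.

Definition anc {T : rtree} (x y : T) : bool := fconnect par y x.

(** The root is excluded, since it would otherwise be a child of itself. *)
Definition children {T : rtree} (x : T) : {set T} :=
  [set c | (c != troot) && (par c == x)].

Lemma anc_refl (T : rtree) (x : T) : anc x x.
Proof. exact: connect0. Qed.

Lemma anc_trans (T : rtree) (y x z : T) : anc x y -> anc y z -> anc x z.
Proof. by move=> xy yz; apply: connect_trans yz xy. Qed.

Lemma anc_par (T : rtree) (x : T) : anc (par x) x.
Proof. exact: fconnect1. Qed.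

Lemma ancP (T : rtree) (x y : T) : reflect (exists n, iter n par y = x) (anc x y).
Proof.
apply: (iffP idP) => [xy|[n <-]]; last exact: fconnect_iter.
by exists (findex par y x); exact: iter_findex.
Qed.

Lemma rtree_ind (T : rtree) (P : T -> Prop) :
  P troot -> (forall x, x != troot -> P (par x) -> P x) -> forall x, P x.
Proof.
move=> P0 PS x; have [n] := ubnP (height x); elim: n x => // n IH x lexn.
have [->//|xr] := eqVneq x troot; apply: PS => //; apply: IH.
exact: leq_trans (height_par xr) lexn.
Qed.

Lemma anc_root (T : rtree) (x : T) : anc troot x.
Proof.
elim/rtree_ind: x => [|x _ IH]; first exact: anc_refl.
exact: anc_trans IH (anc_par x).
Qed.

Lemma anc_parr (T : rtree) (x y : T) : anc x y -> x != y -> anc x (par y).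
Proof.
case/ancP=> [[|n]] /= <-; first by rewrite eqxx.
by move=> _; rewrite -iterS iterSr; exact: fconnect_iter.
Qed.

Lemma anc_height (T : rtree) (x y : T) : anc x y -> x != y -> (height x < height y).
Proof.
elim/rtree_ind: y => [|y yr IH] xy nxy.
  have := anc_parr xy nxy; rewrite par_root.
  by case/ancP: xy nxy => n <-; rewrite iter_fix ?eqxx ?par_root.
have [->|nxp] := eqVneq x (par y); first exact: height_par.
exact: ltn_trans (IH (anc_parr xy nxy) nxp) (height_par yr).
Qed.

Lemma anc_anti (T : rtree) (x y : T) : anc x y -> anc y x -> x = y.
Proof.
move=> xy yx; apply/eqP/contraT => nxy.
have := anc_height xy nxy; rewrite eq_sym in nxy.
by move=> lt1; have := ltn_trans lt1 (anc_height yx nxy); rewrite ltnn.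
Qed.

Lemma anc_total (T : rtree) (z x y : T) : anc x z -> anc y z -> anc x y || anc y x.
Proof.
move=> /ancP [m <-] /ancP [n <-]; case: (leqP m n) => [|/ltnW] le_mn.
  by rewrite -(subnK le_mn) iterD [X in _ || X]fconnect_iter orbT.
by rewrite -(subnK le_mn) iterD [X in X || _]fconnect_iter.
Qed.

Lemma anc_child (T : rtree) (x y : T) :
  anc x y -> x != y -> exists2 c, c \in children x & anc c y.
Proof.
elim/rtree_ind: y => [|y yr IH] xy nxy.
  by rewrite (anc_anti xy (anc_root _)) eqxx in nxy.
have [->|nxp] := eqVneq x (par y).
  by exists y; rewrite ?inE ?yr ?eqxx ?anc_refl.
have [c cx cy] := IH (anc_parr xy nxy) nxp.
by exists c => //; apply: anc_trans cy (anc_par y).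
Qed.

(** A common ancestor of maximal height works: the ancestors of [a] form a chain, and height
    increases strictly along it. *)
Lemma anc_meet (T : rtree) (a b : T) :
  exists2 m, anc m a && anc m b & forall z, anc z a -> anc z b -> anc z m.
Proof.
pose P z := anc z a && anc z b.
have P0 : P troot by rewrite /P !anc_root.
case: (@arg_maxnP _ troot P height P0) => m /[dup] Pm /andP [ma mb] max_m.
exists m => // z za zb; case/orP: (anc_total za ma) => // mz.
have [->|nmz] := eqVneq m z; first exact: anc_refl.
have /= := max_m z; rewrite /P za zb => /(_ isT).
by rewrite /geq leqNgt /= anc_height.
Qed.

(** * Tree paths and subtrees *)

(** The nodes of the tree path from [a] to [b]: ancestors of an end that lie below the meet, where
    the meet is replaced by all common ancestors so that it need not be named. *)
Definition on_path {T : rtree} (a b x : T) : bool :=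
  (anc x a || anc x b) && [forall z, (anc z a && anc z b) ==> anc z x].

Lemma on_pathP (T : rtree) (a b x : T) :
  reflect ((anc x a \/ anc x b) /\ forall z, anc z a -> anc z b -> anc z x)
          (on_path a b x).
Proof.
apply: (iffP andP) => [[/orP xab /forallP H]|[/orP xab H]]; split=> //.
  by move=> z za zb; have := H z; rewrite za zb.
by apply/forallP=> z; apply/implyP=> /andP [za zb]; exact: H.
Qed.

Lemma on_pathC (T : rtree) (a b x : T) : on_path a b x = on_path b a x.
Proof.
by rewrite /on_path orbC; congr andb; apply: eq_forallb => z; rewrite andbC.
Qed.

Lemma on_path_end (T : rtree) (a b : T) : on_path a b a.
Proof. by apply/on_pathP; split=> //; left; exact: anc_refl. Qed.

(** A nonempty connected set of nodes with top [m]. Closure under parents would hold trivially at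
    the root, hence the clause [x != troot]. *)
Definition subtree_at {T : rtree} (m : T) (S : {set T}) : Prop :=
  m \in S /\ forall x, x \in S -> x != m -> x != troot /\ par x \in S.

Lemma subtree_anc (T : rtree) (m : T) (S : {set T}) (x : T) :
  subtree_at m S -> x \in S -> anc m x.
Proof.
move=> [mS Sm]; elim/rtree_ind: x => [|x _ IH] xS.
  have [->|/Sm] := eqVneq troot m; first exact: anc_refl.
  by case/(_ xS); rewrite eqxx.
have [->|/(Sm _ xS) [_ pS]] := eqVneq x m; first exact: anc_refl.
exact: anc_trans (IH pS) (anc_par x).
Qed.

Lemma subtree_convex (T : rtree) (m : T) (S : {set T}) (x y : T) :
  subtree_at m S -> x \in S -> anc m y -> anc y x -> y \in S.
Proof.
move=> sS; elim/rtree_ind: x => [|x xr IH] xS my yx.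
  by rewrite (anc_anti yx (anc_root _)).
have [<-//|nyx] := eqVneq x y; rewrite eq_sym in nyx.
have [exm|nxm] := eqVneq x m.
  by rewrite exm in yx nyx; rewrite (anc_anti yx my) eqxx in nyx.
by apply: IH => //; [case: (sS.2 x xS nxm) | exact: anc_parr].
Qed.

(** The top is the meet of [a] and [b]. *)
Lemma subtree_path (T : rtree) (a b : T) :
  exists m, subtree_at m [set x | on_path a b x].
Proof.
have [m /andP [ma mb] max_m] := anc_meet a b.
exists m; split; first by rewrite inE; apply/on_pathP; split; [left|].
move=> x; rewrite !inE => /on_pathP [xab Hx] nxm.
have mx := Hx m ma mb; rewrite eq_sym in nxm.
have xr : x != troot.
  by apply: contraNneq nxm => xr; rewrite xr in mx *; rewrite (anc_anti mx (anc_root _)).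
split=> //; apply/on_pathP; split.
  by case: xab => H; [left|right]; exact: anc_trans (anc_par x) H.
by move=> z za zb; exact: anc_trans (max_m z za zb) (anc_parr mx nxm).
Qed.

(** Since the top [m] belongs to its subtree, [rd_subtree] also says that every vertex lies in some
    bag. *)
Record rdecomp (H : sgraph) (T : rtree) (bag : T -> {set H}) : Prop := RDecomp {
  rd_subtree : forall v, exists m, subtree_at m [set t | v \in bag t];
  rd_edge : forall u v, adj u v -> exists t, (u \in bag t) && (v \in bag t) }.

(** * Replacing nodes by chains of copies *)

Lemma inord_pred (n : nat) (i : 'I_n.+1) : inord (n' := n) i.-1 = i.-1 :> nat.
Proof. by rewrite inordK // (leq_ltn_trans (leq_pred _)). Qed.

(* Every node [y] becomes a path [(y, 0)], ..., [(y, n)] going down, and the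
   path of a child [c] of [y] is hung below [(y, idx c)]. *)
Definition chain_par (T : rtree) (n : nat) (idx : T -> 'I_n.+1) (p : T * 'I_n.+1) :
    T * 'I_n.+1 :=
  if p.2 == ord0 then if p.1 == troot then p else (par p.1, idx p.1)
  else (p.1, inord p.2.-1).

Lemma chain_par_root (T : rtree) (n : nat) (idx : T -> 'I_n.+1) :
  chain_par idx (troot, ord0) = (troot, ord0).
Proof. by rewrite /chain_par !eqxx. Qed.

(** [h] encodes the lexicographic order on the height in [T] and the position in the chain. *)
Lemma chain_height_par (T : rtree) (n : nat) (idx : T -> 'I_n.+1) (p : T * 'I_n.+1) :
  let h (q : T * 'I_n.+1) := height q.1 * n.+1 + q.2 in
  p != (troot, ord0) -> h (chain_par idx p) < h p.
Proof.
case: p => y i /=; rewrite xpair_eqE /chain_par /=.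
have [->|i0] := eqVneq i ord0.
  rewrite andbT => yr; rewrite (negPf yr) /= addn0.
  apply: leq_trans (_ : (height (par y)).+1 * n.+1 <= _).
    by rewrite mulSn addnC ltn_add2r.
  by rewrite leq_mul2r height_par ?orbT.
move=> _ /=; rewrite inord_pred.
by rewrite ltn_add2l ltn_predL lt0n -val_eqE in i0 *.
Qed.

Definition chain (T : rtree) (n : nat) (idx : T -> 'I_n.+1) : rtree :=
  RTree (chain_par_root idx) (@chain_height_par T n idx).

Lemma rdecomp_chain (H : sgraph) (T : rtree) (n : nat) (idx : T -> 'I_n.+1)
    (bag : T -> {set H}) :
  rdecomp bag -> rdecomp (T := chain idx) (fun p => bag p.1).
Proof.
move=> [sub edg]; split=> [v|u v /edg [t Ht]]; last by exists (t, ord0).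
have [m [mS Sm]] := sub v; exists (m, ord0); split; first by rewrite !inE in mS *.
move=> [y i]; rewrite !inE /= => yS nym; rewrite /chain_par /=.
have [i0|i0] := eqVneq i ord0; last by rewrite !xpair_eqE (negPf i0) andbF.
move: nym; rewrite i0 xpair_eqE eqxx andbT => /Sm.
by rewrite !inE => /(_ yS) [yr]; rewrite xpair_eqE (negPf yr).
Qed.

Lemma chain_anc_fst (T : rtree) (n : nat) (idx : T -> 'I_n.+1) (p q : chain idx) :
  anc p q -> anc p.1 q.1.
Proof.
case/ancP=> k <-; elim: k => [|k IH] /=; first exact: anc_refl.
apply: anc_trans IH; case: (iter k _ q) => y i /=; rewrite /chain_par /=.
by case: (i == ord0) => /=; [case: (y == troot) => /=|]; rewrite ?anc_refl ?anc_par.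
Qed.

Lemma chain_anc_snd (T : rtree) (n : nat) (idx : T -> 'I_n.+1) (y : T) (i j : 'I_n.+1) :
  (i <= j)%N -> @anc (chain idx) (y, i) (y, j).
Proof.
have [k] := ubnP j; elim: k j => // k IH j ltjk.
rewrite leq_eqVlt => /orP [/eqP/val_inj->|ltij]; first exact: anc_refl.
have j_gt0 : 0 < j by exact: leq_ltn_trans ltij.
have j0 : j != ord0 by rewrite -val_eqE /= -lt0n.
apply: (@anc_trans (chain idx) (par (r := chain idx) (y, j))); last exact: anc_par.
rewrite /= /chain_par /= (negPf j0).
apply: IH; rewrite inord_pred; last by rewrite -ltnS prednK.
by rewrite -ltnS prednK.
Qed.

(** With all children hung below last copies, the way from the root down to the last copy of [y]
    runs through every copy of every ancestor of [y]. *)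
Lemma chain_anc (T : rtree) (n : nat) (x y : T) (i : 'I_n.+1) :
  anc x y -> @anc (chain (fun _ : T => @ord_max n)) (x, i) (y, ord_max).
Proof.
set C := chain _.
elim/rtree_ind: y => [|y yr IH] xy.
  by rewrite (anc_anti xy (anc_root _)); apply: chain_anc_snd; rewrite leq_ord.
have [->|nxy] := eqVneq x y; first by apply: chain_anc_snd; rewrite leq_ord.
apply: (@anc_trans C _ _ _ (IH (anc_parr xy nxy))).
apply: (@anc_trans C (y, ord0)); last exact: chain_anc_snd.
have -> : (par y, ord_max) = par (r := C) (y, ord0).
  by rewrite /= /chain_par /= (negPf yr).
exact: anc_par.
Qed.

(** A last copy inherits the children of its node; any other copy has only the next copy as a child,
    whence [0 < d]. *)
Lemma chain_children_last (T : rtree) (n d : nat) :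
  0 < d -> (forall x : T, #|children x| <= d) ->
  forall p, #|@children (chain (fun _ : T => @ord_max n)) p| <= d.
Proof.
move=> d0 Td [y i]; have [i_max|i_max] := eqVneq i ord_max.
  apply: leq_trans (Td y); rewrite -[X in _ <= X](card_imset _ (f := fun c => (c, @ord0 n))).
apply: subset_leq_card; apply/subsetP => -[z j]; rewrite !inE /= /chain_par /= => /andP [].
    have [->|j0] := eqVneq j ord0.
      rewrite xpair_eqE eqxx andbT => zr; rewrite (negPf zr) xpair_eqE => /andP [/eqP <- _].
      by rewrite imset_f // inE zr eqxx.
    move=> _ /eqP [_ /(congr1 val) /=]; rewrite inord_pred.
    by rewrite i_max /= => jn; rewrite -val_eqE /= in j0; have := ltn_ord j; lia.
  by move=> c1 c2 [].
apply: leq_trans d0; rewrite -[X in _ <= X](cards1 ((y, inord i.+1) : T * 'I_n.+1)).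
apply: subset_leq_card; apply/subsetP => -[z j]; rewrite !inE /= /chain_par /= => /andP [].
have [->|j0] := eqVneq j ord0.
  rewrite xpair_eqE eqxx andbT => zr; rewrite (negPf zr) xpair_eqE => /andP [_ /eqP e].
  by rewrite e eqxx in i_max.
move=> _ /eqP [-> <-]; rewrite xpair_eqE eqxx -val_eqE /=.
have j_gt0 : 0 < j by rewrite lt0n.
by rewrite inord_pred prednK // inord_val.
Qed.

(** At most one original child hangs at each copy, and the next copy is the only other child. This
    makes any rooted tree binary. *)
Lemma chain_children_inj (T : rtree) (n : nat) (idx : T -> 'I_n.+1) :
  injective idx -> forall p : chain idx, #|children p| <= 2.
Proof.
move=> idx_inj [y i].
pose below := [set (z, @ord0 n) | z : T & (z != troot) && (par z == y) && (idx z == i)].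
have s1 : #|below| <= 1.
  rewrite leqNgt; apply/negP => /card_gt1P [_ [_ [/imsetP [z1 +  ->] /imsetP [z2 + ->]]]].
  by rewrite !inE => /andP [_ /eqP <-] /andP [_ /eqP/idx_inj ->]; rewrite eqxx.
have s2 := cards1 ((y, inord i.+1) : T * 'I_n.+1).
apply: leq_trans (_ : #|below :|: [set (y, inord i.+1)]| <= _).
  apply: subset_leq_card; apply/subsetP => -[z j]; rewrite !inE /= /chain_par /= => /andP [].
  have [->|j0] := eqVneq j ord0.
    rewrite xpair_eqE eqxx andbT => zr; rewrite (negPf zr) xpair_eqE => /andP [ey ei].
    by rewrite imset_f // !inE zr ey ei.
  move=> _ /eqP [-> <-]; rewrite [X in _ || X]xpair_eqE eqxx -val_eqE /=.
  have j_gt0 : 0 < j by rewrite lt0n.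
  by rewrite inord_pred prednK // inord_val eqxx orbT.
apply: leq_trans (leq_card_setU _ _) _.
by rewrite s2 addn1.
Qed.

(** * Counting lemmas *)

Lemma leq_sqr_sum (I : finType) (D : {set I}) (n : I -> nat) :
  (\sum_(i in D) n i) ^ 2 <= #|D| * \sum_(i in D) n i ^ 2.
Proof.
rewrite -(leq_pmul2l (isT : 0 < 2)).
apply: leq_trans (_ : \sum_(i in D) \sum_(j in D) (n i ^ 2 + n j ^ 2) <= _).
  rewrite -mulnn big_distrl big_distrr /=; apply: leq_sum => i _.
  by rewrite !big_distrr /=; apply: leq_sum => j _; exact: nat_Cauchy.
rewrite (eq_bigr (fun i => #|D| * n i ^ 2 + \sum_(j in D) n j ^ 2)) => [|i _].
  by rewrite big_split /= -big_distrr sum_nat_const /=; lia.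
by rewrite big_split sum_nat_const.
Qed.

(* Turan's bound, for a graph that is complete multipartite with at most [d.+1] parts. *)
Lemma leq_sum_bichromatic (I C : finType) (U : {set I}) (D : {set C}) (f : I -> C)
    (d : nat) :
  {in U, forall u, f u \in D} -> #|D| <= d.+1 ->
  d.+1 * \sum_(u in U) #|[set w in U | f u != f w]| <= d * #|U| ^ 2.
Proof.
move=> fD Dd; pose n c := #|[set u in U | f u == c]|.
have cardU : #|U| = \sum_(c in D) n c.
  rewrite -sum1_card (partition_big f (mem D)) //=; apply: eq_bigr => c _.
  by rewrite sum1dep_card.
have cardS : \sum_(u in U) n (f u) = \sum_(c in D) n c ^ 2.
  rewrite (partition_big f (mem D)) //=; apply: eq_bigr => c _.
  rewrite (eq_bigr (fun=> n c)) => [|u /andP [_ /eqP ->] //].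
  by rewrite sum_nat_cond_const -mulnn; congr (_ * _); apply: eq_card => u; rewrite !inE.
have tot : \sum_(u in U) #|[set w in U | f u != f w]| + \sum_(u in U) n (f u) = #|U| ^ 2.
  rewrite -big_split -mulnn -sum_nat_const /=; apply: eq_bigr => u _.
  rewrite -(cardsID [set w | f u != f w] U) setIdE; congr (_ + _).
  by apply: eq_card => w; rewrite !inE negbK eq_sym andbC.
have := leq_sqr_sum D n; rewrite -cardU -cardS -tot.
set X := \sum_(u in U) _; set Y := \sum_(u in U) _ => H.
(* [X] counts the ordered pairs with different colours and [Y] those with equal colours. So
   [X <= d * Y], and adding [d * X] to both sides gives the claim. *)
have : X + Y <= d.+1 * Y by exact: leq_trans H (leq_mul Dd _).
by rewrite mulSn mulnDr mulSn; lia.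
Qed.

Lemma leq_card_bigcup (I T : finType) (D : {set I}) (A : I -> {set T}) :
  #|\bigcup_(i in D) A i| <= \sum_(i in D) #|A i|.
Proof.
elim/big_rec2: _ => [|i n B _ IH]; first by rewrite cards0.
by apply: leq_trans (leq_card_setU _ _) _; rewrite leq_add2l.
Qed.

Lemma set2_inj (T : finType) (a b c d : T) :
  [set a; b] = [set c; d] -> a = c /\ b = d \/ a = d /\ b = c.
Proof.
move=> E; have /set2P ha : a \in [set c; d] by rewrite -E set21.
have /set2P hb : b \in [set c; d] by rewrite -E set22.
have /set2P hc : c \in [set a; b] by rewrite E set21.
have /set2P hd : d \in [set a; b] by rewrite E set22.
by case: ha => ?; case: hb => ?; case: hc => ?; case: hd => ?; subst; auto.
Qed.

(** Every unordered pair in the image comes from two distinct ordered pairs. *)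
Lemma card_unordered_pairs (T : finType) (Q : {set T * T}) :
  (forall u w, (u, w) \in Q -> (w, u) \in Q) -> (forall u, (u, u) \notin Q) ->
  2 * #|[set [set p.1; p.2] | p in Q]| <= #|Q|.
Proof.
move=> Qsym Qirr; pose F (p : T * T) := [set p.1; p.2].
rewrite -[X in _ <= X]sum1_card (partition_big_imset F) mulnC -sum_nat_const /=.
apply: leq_sum => _ /imsetP [[u w] uwQ ->]; rewrite sum1dep_card.
apply/card_gt1P; exists (u, w), (w, u); rewrite !inE; split.
- by rewrite uwQ eqxx.
- by rewrite Qsym //= /F /= setUC.
- by apply: contraNneq (Qirr u) => -[e _]; rewrite {2}e.
Qed.

(** * The decomposition of the line graph *)

Lemma line_vertexP (G : sgraph) (e : line_vertex G) :
  exists v w, adj v w /\ val e = [set v; w].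
Proof.
have := valP e; rewrite inE => /existsP [v /existsP [w /andP [vw /eqP E]]].
by exists v, w.
Qed.

Definition line_bag (G : sgraph) (T : rtree) (b : G -> T) (x : T) :
    {set line_graph G} :=
  [set e : line_vertex G |
    [exists v, exists w, (val e == [set v; w]) && on_path (b v) (b w) x]].

Lemma in_line_bag (G : sgraph) (T : rtree) (b : G -> T) (x : T) (e : line_graph G) v w :
  val e = [set v; w] -> (e \in line_bag b x) = on_path (b v) (b w) x.
Proof.
move=> Ee; rewrite inE; apply/existsP/idP => [[v' /existsP [w' /andP []]]|vw].
  by rewrite Ee => /eqP/set2_inj [[-> ->]|[-> ->]] //; rewrite on_pathC.
by exists v; apply/existsP; exists w; rewrite Ee eqxx.
Qed.

(** The nodes holding an edge form a tree path, and two edges sharing [v] are both held at [b v]. *)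
Lemma line_rdecomp (G : sgraph) (T : rtree) (b : G -> T) : rdecomp (line_bag b).
Proof.
split=> [e|e f /andP [_ /set0Pn [v]]].
  have [v [w [_ Ee]]] := line_vertexP e.
  have [m sm] := subtree_path (b v) (b w); exists m.
  congr subtree_at: sm; apply/setP => x; rewrite [LHS]inE [RHS]inE.
  by rewrite (in_line_bag _ _ Ee).
have end_bag (g : line_graph G) : v \in val g -> g \in line_bag b (b v).
  have [x [y [_ Eg]]] := line_vertexP g; rewrite Eg => /set2P [] ->.
    by rewrite (in_line_bag _ _ Eg) on_path_end.
  by rewrite (in_line_bag _ _ Eg) on_pathC on_path_end.
by rewrite inE => /andP [ve vf]; exists (b v); rewrite !end_bag.
Qed.

(** The subtrees of adjacent vertices meet, so their union is connected and contains the path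
    between the base nodes. *)
Lemma on_path_bag (G : sgraph) (T : rtree) (bag : T -> {set G}) (b : G -> T) v w x :
  rdecomp bag -> (forall u, u \in bag (b u)) -> adj v w -> on_path (b v) (b w) x ->
  (v \in bag x) || (w \in bag x).
Proof.
move=> [sub edg] bb vw.
wlog xv : v w vw / anc x (b v) => [IH|] /on_pathP [xab Hx].
  case: xab => [xv|xw]; first by apply: (IH v w vw xv); apply/on_pathP; split; auto.
  by rewrite orbC; apply: (IH w v) => //; [rewrite adj_sym|
    rewrite on_pathC; apply/on_pathP; split; auto].
have [mv sv] := sub v; have [mw sw] := sub w; have [c /andP [vc wc]] := edg v w vw.
have mvb : anc mv (b v) by apply: subtree_anc sv _; rewrite inE.
have mwb : anc mw (b w) by apply: subtree_anc sw _; rewrite inE.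
have mvc : anc mv c by apply: subtree_anc sv _; rewrite inE.
have mwc : anc mw c by apply: subtree_anc sw _; rewrite inE.
have in_v : anc mv x -> v \in bag x.
  by move=> mx; have := subtree_convex (x := b v) (y := x) sv; rewrite !inE => ->.
case/orP: (anc_total xv mvb) => [xmv|/in_v -> //].
have in_w : anc mw x -> w \in bag x.
  move=> mx; have := subtree_convex (x := c) (y := x) sw; rewrite !inE => -> //.
  exact: anc_trans xmv mvc.
(* Both tops lie above the shared node [c]. The upper one is a common ancestor of both base nodes,
   hence an ancestor of [x]. *)
case/orP: (anc_total mvc mwc) => [vw_|wv].
  by rewrite in_v // Hx // (anc_trans vw_ mwb).
by rewrite in_w ?orbT // Hx // (anc_trans wv mvb).
Qed.

(** * Components around a node and the size of a bag *)

(** The component of the tree minus [x] that contains [a], named by a child of [x], or [None] for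
    the part not below [x]. The value at [a = x] is also [None], a mere default. *)
Definition branch {T : rtree} (x a : T) : option T :=
  if anc x a then [pick c in children x | anc c a] else None.

Definition branches {T : rtree} (x : T) : {set option T} :=
  None |: Some @: children x.

Lemma card_branches (T : rtree) (x : T) : #|branches x| <= #|children x|.+1.
Proof.
by rewrite (leq_trans (leq_card_setU _ _)) // cards1 add1n ltnS leq_imset_card.
Qed.

Lemma branch_in (T : rtree) (x a : T) : branch x a \in branches x.
Proof.
rewrite /branch; case: ifP => _; last exact: setU11.
by case: pickP => [c /andP [cx _]|_]; [rewrite inE imset_f ?orbT|exact: setU11].
Qed.

Lemma child_anc (T : rtree) (x c : T) : c \in children x -> ~~ anc c x.
Proof.
rewrite inE => /andP [cr /eqP pc]; apply/negP => cx.
have := height_par cr; rewrite pc ltnNge.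
have [->|nxc] := eqVneq c x; first by rewrite leqnn.
by rewrite ltnW // anc_height.
Qed.

(** One end lies strictly below [x], under a child [c]. If the other end were under [c] too, [c]
    would be a common ancestor of the ends and hence an ancestor of [x]. *)
Lemma on_path_branch (T : rtree) (a b x : T) :
  on_path a b x -> a != x -> b != x -> branch x a != branch x b.
Proof.
move=> /on_pathP [xab Hx]; rewrite ![_ == x]eq_sym => nax nbx.
have some_branch y : x != y -> anc x y ->
    exists c, [/\ branch x y = Some c, c \in children x & anc c y].
  move=> nxy xy; rewrite /branch xy; case: pickP => [c /andP [cx cy]|none].
    by exists c.
  by have [c cx cy] := anc_child xy nxy; have := none c; rewrite cx cy.
apply/eqP => Eb; case: xab => [xa|xb].
  have [c [Ec cx ca]] := some_branch a nax xa.
  have xb : anc x b by apply: contraPT (Eb) => /negbTE nb; rewrite Ec {1}/branch nb.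
  have [c' [Ec' _ cb]] := some_branch b nbx xb.
  have e : c' = c by move: Eb; rewrite Ec Ec' => -[].
  by have := child_anc cx; rewrite Hx // -e.
have [c [Ec cx cb]] := some_branch b nbx xb.
have xa : anc x a by apply: contraPT (Eb) => /negbTE na; rewrite Ec {1}/branch na.
have [c' [Ec' _ ca]] := some_branch a nax xa.
have e : c' = c by move: Eb; rewrite Ec Ec' => -[].
by have := child_anc cx; rewrite Hx // -e.
Qed.

Lemma card_neighbors (G : sgraph) (v : G) : #|neighbors v| <= max_degree G.
Proof. exact: (leq_bigmax v). Qed.

(** The factor [2 * d.+1] clears denominators: edges at [v0] contribute [2 * d.+1 * D], edges
    leaving the bag [2 * d * k * D], and edges inside it [d * k ^ 2]. *)
Lemma card_line_bag (G : sgraph) (T : rtree) (bag : T -> {set G}) (b : G -> T)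
    (d k : nat) (x : T) :
  let D := max_degree G in
  rdecomp bag -> (forall u, u \in bag (b u)) -> injective b ->
  (#|children x| <= d) -> (#|bag x| <= k.+1) ->
  (forall v, v \in bag x -> b v != x ->
    d.+1 * #|[set w in neighbors v | (w \notin bag x) && on_path (b v) (b w) x]| <= d * D) ->
  2 * d.+1 * #|line_bag b x| <= 2 * d * k.+1 * D + 2 * D + d * k ^ 2.
Proof.
move=> D dec bb b_inj xd xk bal.
(* [v0] is the vertex based at [x] if there is one, and otherwise any vertex of the bag. *)
have [[v0 v0x v0_max]|none] : (exists2 v0, v0 \in bag x & forall u, b u = x -> u = v0)
    \/ bag x = set0.
- have [/existsP [v0 /eqP e]|/existsPn none] := boolP [exists v, b v == x].
    by left; exists v0 => [|u]; rewrite -?e ?bb // => /b_inj.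
  have [->|[v0 v0x]] := set_0Vmem (bag x); [by right|left].
  by exists v0 => // u /eqP; rewrite (negPf (none u)).
- pose U := bag x :\ v0; pose P u w := on_path (b u) (b w) x.
  pose out u := [set w in neighbors u | (w \notin bag x) && P u w].
  pose E0 := [set [set v0; w] | w in neighbors v0].
  pose OUT := \bigcup_(u in U) [set [set u; w] | w in out u].
  pose Q := [set p | [&& p.1 \in U, p.2 \in U, adj p.1 p.2 & P p.1 p.2]].
  pose CROSS := [set [set p.1; p.2] | p in Q].
  have cover : val @: line_bag b x \subset E0 :|: OUT :|: CROSS.
    apply/subsetP => _ /imsetP [e ex ->]; have [v [w [vw Ee]]] := line_vertexP e.
    move: ex; rewrite (in_line_bag _ _ Ee) Ee {e Ee} => pvw.
    wlog vx : v w vw pvw / v \in bag x => [IH|].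
      case/orP: (on_path_bag dec bb vw pvw) => [/IH|wx]; first exact.
      by rewrite setUC; apply: IH wx; [rewrite adj_sym|rewrite on_pathC].
    have [ev|nv] := eqVneq v v0.
      by rewrite !inE -orbA; apply/orP; left; apply/imsetP; exists w; rewrite ?inE -?ev.
    have [ew|nw] := eqVneq w v0.
      rewrite !inE -orbA; apply/orP; left; apply/imsetP; exists v; last by rewrite ew setUC.
      by rewrite inE adj_sym -ew.
    have vU : v \in U by rewrite !inE nv.
    rewrite !inE; case: (boolP (w \in bag x)) => wx.
      apply/orP; right; apply/imsetP; exists (v, w) => //.
      by rewrite inE vU !inE nw wx vw.
    apply/orP; left; apply/orP; right; apply/bigcupP; exists v => //.
    by apply/imsetP; exists w => //; rewrite !inE vw wx.
  have cE0 : #|E0| <= D by rewrite (leq_trans (leq_imset_card _ _)) ?card_neighbors.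
  have nbx u : u \in U -> b u != x.
    by rewrite !inE => /andP [nu _]; apply: contraNneq nu => /v0_max ->.
  have cOUT : d.+1 * #|OUT| <= #|U| * (d * D).
    rewrite -sum_nat_const; apply: leq_trans (_ : \sum_(u in U) d.+1 * #|out u| <= _).
      rewrite -big_distrr /= leq_mul2l; apply/orP; right; apply: leq_trans (leq_card_bigcup _ _) _.
      by apply: leq_sum => u _; exact: leq_imset_card.
    apply: leq_sum => u uU; apply: bal (nbx u uU).
    by move: uU; rewrite !inE => /andP [].
  (* Colour [u] by the branch of [b u] at [x]: the pairs in [Q] get distinct colours, out of at most
     [d.+1]. *)
  have cCROSS : d.+1 * (2 * #|CROSS|) <= d * #|U| ^ 2.
    have := leq_sum_bichromatic (U := U) (D := branches x) (f := fun u => branch x (b u)).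
    move=> /(_ d (fun u _ => branch_in x (b u)) (leq_trans (card_branches x) (xd : _ < d.+1))).
    apply: leq_trans; rewrite leq_mul2l /=; apply: leq_trans (_ : #|Q| <= _).
      apply: card_unordered_pairs => [u w|u]; rewrite !inE /=; last by rewrite adj_irrefl !andbF.
      by rewrite adj_sym /P on_pathC => /and4P [-> -> -> ->].
    rewrite -sum1_card (partition_big fst (mem U)) => [|p]; last by rewrite inE => /andP [].
    apply: leq_sum => u uU; rewrite sum1dep_card.
    rewrite -[X in _ <= X](card_imset _ (f := pair u)) => [|? ? [] //].
    apply: subset_leq_card; apply/subsetP => -[u' w]; rewrite !inE /=.
    move=> /andP [/and4P [_ wU _ p] /eqP e].
    move: p; rewrite e => p; apply: imset_f; rewrite !inE wU /=.
    by apply: on_path_branch => //; apply: nbx => //; rewrite !inE.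
  have cU : #|U| <= k by move: xk; rewrite (cardsD1 v0) v0x.
  rewrite -(card_imset _ val_inj).
  have := leq_trans (leq_card_setU _ _) (leq_add (leq_card_setU E0 OUT) (leqnn #|CROSS|)).
  move/(leq_trans (subset_leq_card cover)).
  set L := #|_|; move=> cL.
  have H1 : #|U| * (d * D) <= k * (d * D) by rewrite leq_mul2r cU orbT.
  have H2 : d * #|U| ^ 2 <= d * k ^ 2 by rewrite leq_mul2l leq_exp2r ?cU ?orbT.
  have H3 : d.+1 * #|E0| <= d.+1 * D by rewrite leq_mul2l cE0 orbT.
  have H4 : d.+1 * L <= d.+1 * (#|E0| + #|OUT| + #|CROSS|) by rewrite leq_mul2l cL orbT.
  clear -H1 H2 H3 H4 cOUT cCROSS; nia.
- have -> : line_bag b x = set0.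
    apply/setP => e; rewrite in_set0; have [v [w [vw Ee]]] := line_vertexP e.
    rewrite (in_line_bag _ _ Ee); apply/negP => /(on_path_bag dec bb vw).
    by rewrite none !inE.
  by rewrite cards0 muln0.
Qed.

(** * Balanced base nodes *)

(** Take [y] of maximal height in [S] among the nodes with at least a [1 / d.+1] share of the weight
    below them. Then at most [d / d.+1] is outside, and each of the at most [d] children carries at
    most a [1 / d.+1] share. *)
Lemma balanced_node (T : rtree) (I : finType) (m : T) (S : {set T}) (A : {set I})
    (c : I -> T) (d : nat) :
  subtree_at m S -> {in A, forall w, c w \in S} -> (forall x : T, #|children x| <= d) ->
  exists y, [/\ y \in S,
    d.+1 * #|[set w in A | ~~ anc y (c w)]| <= d * #|A| &
    d.+1 * #|[set w in A | anc y (c w) && (c w != y)]| <= d * #|A|].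
Proof.
move=> sS cS Td; pose wt y := #|[set w in A | anc y (c w)]|.
pose P y := (y \in S) && (#|A| <= d.+1 * wt y).
have Pm : P m.
  rewrite /P sS.1 mulSn /=; apply: leq_trans (leq_addr _ _).
  apply: subset_leq_card; apply/subsetP => w wA; rewrite inE wA.
  exact: subtree_anc sS (cS w wA).
case: (@arg_maxnP _ m P height Pm) => y /andP [yS Py] max_y; exists y; split=> //.
  have := cardsID [set w | anc y (c w)] A; rewrite -setIdE -/(wt y).
  have -> : A :\: [set w | anc y (c w)] = [set w in A | ~~ anc y (c w)].
    by apply/setP => w; rewrite !inE andbC.
  by set X := #|_|; nia.
apply: leq_trans (_ : \sum_(z in children y) d.+1 * wt z <= _).
  rewrite -big_distrr /= leq_mul2l; apply/orP; right.
  apply: leq_trans (leq_card_bigcup _ (fun z => [set w in A | anc z (c w)])).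
  apply: subset_leq_card; apply/subsetP => w; rewrite inE eq_sym => /and3P [wA yw nyw].
  have [z zy zw] := anc_child yw nyw.
  by apply/bigcupP; exists z => //; rewrite inE wA.
apply: leq_trans (_ : \sum_(z in children y) #|A| <= _); last first.
  by rewrite sum_nat_const leq_mul2r Td orbT.
apply: leq_sum => z zy; rewrite leqNgt; apply/negP => lt_wt.
(* A child that is too heavy lies above some [c w], so it is in [S] by convexity and contradicts the
   choice of [y]. *)
have [w] : exists w, w \in [set w in A | anc z (c w)].
  by apply/set0Pn; apply: contraTneq lt_wt => e; rewrite /wt e cards0 muln0.
rewrite inE => /andP [wA zw]; move: (zy); rewrite inE => /andP [zr /eqP pz].
have yz : anc y z by rewrite -pz anc_par.
have zS : z \in S.
  apply: (subtree_convex sS (cS w wA) _ zw); exact: anc_trans (subtree_anc sS yS) yz.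
have /= := max_y z; rewrite /P zS (ltnW lt_wt) => /(_ isT).
by rewrite /geq /= -pz leqNgt height_par.
Qed.

(** For balancing, a neighbour [w] of [v] is represented by a node [c w] whose bag holds both, not
    by its base node; so the base nodes can be chosen independently of each other. *)
Lemma line_rdecomp_bounded (G : sgraph) (T : rtree) (bag : T -> {set G}) (d k : nat) :
  let D := max_degree G in
  0 < #|G| -> 0 < d -> rdecomp bag ->
  (forall x : T, #|children x| <= d) -> (forall x, #|bag x| <= k.+1) ->
  exists (T' : rtree) (bag' : T' -> {set line_graph G}),
    [/\ rdecomp bag', forall x : T', #|children x| <= d &
      forall x, 2 * d.+1 * #|bag' x| <= 2 * d * k.+1 * D + 2 * D + d * k ^ 2].
Proof.
move=> D G_gt0 d_gt0 dec Td Tk.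
have [n [idx idx_inj]] : exists n, exists idx : G -> 'I_n.+1, injective idx.
  exists #|G|.-1, (fun v => inord (enum_rank v)) => u v /(congr1 val) /=.
  by rewrite !inordK ?prednK // => /val_inj/enum_rank_inj.
pose C := chain (fun _ : T => @ord_max n).
pose bagC (p : C) := bag p.1.
have decC : rdecomp bagC by exact: rdecomp_chain.
have /fin_all_exists [y Hy] : forall v, exists y, v \in bag y /\ exists c : G -> T,
    [/\ {in neighbors v, forall w, w \in bag (c w)},
     d.+1 * #|[set w in neighbors v | ~~ anc y (c w)]| <= d * D &
     d.+1 * #|[set w in neighbors v | anc y (c w) && (c w != y)]| <= d * D].
  move=> v.
  have /fin_all_exists [c Hc] : forall w, exists t, adj v w -> (v \in bag t) && (w \in bag t).
    move=> w; case: (boolP (adj v w)) => [/(rd_edge dec) [t Ht]|_].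
      by exists t.
    by exists troot.
  have [m sm] := rd_subtree dec v.
  have [w|z [zS H1 H2]] := balanced_node (A := neighbors v) (c := c) sm _ Td.
    by rewrite !inE => /Hc /andP [].
  have dD : d * #|neighbors v| <= d * D by rewrite leq_mul2l card_neighbors orbT.
  exists z; split; first by rewrite inE in zS.
  exists c; split; [|exact: leq_trans H1 dD|exact: leq_trans H2 dD].
  by move=> w; rewrite inE => /Hc /andP [].
pose b v : C := (y v, idx v).
have b_inj : injective b by move=> u v [_ /idx_inj].
have bb v : v \in bagC (b v) by case: (Hy v).
exists C, (line_bag b); split; first exact: line_rdecomp.
  exact: chain_children_last.
move=> x; apply: (card_line_bag decC bb b_inj (chain_children_last d_gt0 Td x) (Tk x.1)).
move=> v vx nbx; have [_ [c [cw light_out light_in]]] := Hy v.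
set X := [set w in _ | _].
(* The last copy lies below [b v] as soon as [c w] is weakly below [y v], whatever the index of
   [v]. *)
pose c' w : C := (c w, ord_max).
have top w p : w \in bagC p -> forall m, subtree_at m [set t | w \in bagC t] -> anc m p.
  by move=> wp m sm; apply: subtree_anc sm _; rewrite inE.
have XP w : w \in X -> [/\ w \in neighbors v, w \in bagC (c' w), w \notin bagC x
    & on_path (b v) (b w) x].
  by rewrite inE => /andP [wv /andP [wx p]]; split=> //; exact: cw.
have b_c w : anc (y v) (c w) -> anc (b v) (c' w) by exact: chain_anc.
(* If [x] is above [b v], no counted [w] has [c w] below [y v]: otherwise the top of its subtree is
   comparable with [b v], and either order forces [w] into the bag of [x] or [b v = x]. *)
case: (boolP (anc x (b v))) => xv.
  apply: leq_trans light_out; rewrite leq_mul2l; apply/orP; right.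
  apply: subset_leq_card; apply/subsetP => w /XP [wv wc wx /on_pathP [_ Hx]].
  rewrite inE wv; apply/negP => /b_c vc.
  have [m sm] := rd_subtree decC w.
  have nmx : ~~ anc m x.
    apply: contraNN wx => mx.
    have := subtree_convex (x := (c' w)) (y := x) sm.
    by rewrite !inE => -> //; exact: anc_trans xv vc.
  have mw : anc m (b w) by exact: top.
  have mc : anc m (c' w) by exact: top wc _ sm.
  case/orP: (anc_total mc vc) => [mv|vm].
    by rewrite Hx in nmx.
  have vx' : anc (b v) x by apply: Hx (anc_refl _) (anc_trans vm mw).
  by rewrite (anc_anti vx' xv) eqxx in nbx.
(* Now [x] is above [b w], and the subtree of [w] avoids [x], so all of it lies below [x]. *)
have below w : w \in X -> anc x (c' w).
  move=> /XP [wv wc wx /on_pathP [[xv'|xw] _]]; first by rewrite xv' in xv.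
  have [m sm] := rd_subtree decC w.
  have mw : anc m (b w) by exact: top.
  case/orP: (anc_total xw mw) => [xm|mx]; first exact: anc_trans xm (top _ _ wc _ sm).
  have := subtree_convex (x := b w) (y := x) sm.
  by rewrite !inE bb => /(_ isT mx xw); rewrite (negPf wx).
(* If [b v] is above [x], each [c w] is strictly below [y v], as equality would put [w] in the bag
   of [x]. If they are incomparable, no [c w] is below [y v]. *)
case: (boolP (anc (b v) x)) => vx'.
  apply: leq_trans light_in; rewrite leq_mul2l; apply/orP; right.
  apply: subset_leq_card; apply/subsetP => w wX; have [wv wc wx _] := XP w wX.
  have xc := chain_anc_fst (below w wX); have vx1 := chain_anc_fst vx'.
  rewrite inE wv (anc_trans vx1 xc) /=; apply: contraNneq wx => e.
  by rewrite /= e in xc; rewrite /bagC (anc_anti xc vx1) /= -e.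
apply: leq_trans light_out; rewrite leq_mul2l; apply/orP; right.
apply: subset_leq_card; apply/subsetP => w wX; have [wv _ _ _] := XP w wX.
rewrite inE wv; apply/negP => /b_c vc.
by case/orP: (anc_total vc (below w wX)); apply/negP.
Qed.

(** * Rooting trees and paths *)

(** The top is a node [m] of least height. A walk can leave the descendants of [x] only through
    [p x], so if [p x] is not in [S], the walk in [S] from [x] to [m] ends below [x], against
    minimality. *)
Lemma subtree_connected (T : sgraph) (p : T -> T) (r : T) (h : T -> nat)
    (pr : p r = r) (hp : forall x, x != r -> h (p x) < h x) (S : {set T}) :
  let R := RTree pr hp in
  (forall u v, adj u v -> p u = v \/ p v = u) -> connected_in S ->
  (exists v, v \in S) -> exists m : R, subtree_at m S.
Proof.
move=> R padj connS [v vS].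
case: (@arg_minnP _ v (mem S) h vS) => m /= mS min_m; exists m; split=> // x xS nxm.
have not_anc : ~~ @anc R x m.
  apply/negP => xm; have := @anc_height R _ _ xm nxm.
  by rewrite ltnNge; apply/negP; rewrite negbK; exact: min_m.
split; first by apply: contraNneq not_anc => ->; exact: (@anc_root R).
apply: contraNT not_anc => pxS.
have /connectP [s] := connS x m xS mS; set e := (X in path X) => xs ->.
elim/last_ind: s xs => [|s w IH] /=; first by rewrite anc_refl.
rewrite rcons_path last_rcons => /andP [/IH xu] /and3P [uS wS uw] {IH}.
set u := last x s in xu uS uw *.
case: (padj u w uw) => [pu|pw]; last first.
  by rewrite -pw in xu; exact: (@anc_trans R _ _ _ xu (@anc_par R w)).
have [eux|nux] := eqVneq x u; first by rewrite eux /= pu wS in pxS.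
by rewrite -pu; exact: (@anc_parr R).
Qed.

(** Breadth-first rooting: [h] is the distance from [r], and [p] picks a neighbour closer to [r].
    Acyclicity makes every edge a parent edge. *)
Lemma tree_rooting (T : sgraph) : is_tree T ->
  exists (p : T -> T) (r : T) (h : T -> nat), [/\ p r = r,
    forall x, x != r -> h (p x) < h x & forall u v, adj u v -> p u = v \/ p v = u].
Proof.
move=> [/card_gt0P [r _] conn acy].
pose P n x := [exists s : n.-tuple T, path (@adj T) r s && (x == last r s)].
have reach x : exists n, P n x.
  have /connectP [s] := conn r x (in_setT _) (in_setT _).
  rewrite (eq_path (e' := @adj T)) => [rs xs|u v /=]; last by rewrite !inE.
  by exists (size s); apply/existsP; exists (in_tuple s); rewrite rs xs eqxx.
pose h x := ex_minn (reach x).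
have step x : x != r -> exists y, adj x y && (h y < h x).
  move=> xr; rewrite {2}/h; case: ex_minnP => n /existsP [[s /= /eqP <-]] /andP [rs /eqP xs] _.
  case/lastP: s => [|s y] in rs xs *; first by rewrite xs eqxx in xr.
  rewrite last_rcons in xs; rewrite -xs rcons_path adj_sym in rs.
  case/andP: rs => rs xy; exists (last r s); rewrite xy size_rcons ltnS /h.
  case: ex_minnP => m _; apply; apply/existsP; exists (in_tuple s).
  by rewrite rs eqxx.
pose p x := if x == r then r else odflt r [pick y | adj x y && (h y < h x)].
have pP x : x != r -> adj x (p x) && (h (p x) < h x).
  move=> xr; rewrite /p (negPf xr); case: pickP => [y //|none].
  by have [y] := step x xr; rewrite none.
have pr : p r = r by rewrite /p eqxx.
have hp x : x != r -> h (p x) < h x by move=> /pP /andP [].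
exists p, r, h; split=> // u v uv.
case: (eqVneq (p u) v) => [|nuv]; [by left|]; case: (eqVneq (p v) u) => [|nvu]; [by right|].
(* A path of tree edges from [u] to [v] would close up with [uv] into a cycle. *)
pose F a b := (a != b) && ((p a == b) || (p b == a)).
have Fsym : connect_sym F.
  by apply: sym_connect_sym => a b; rewrite /F eq_sym [X in _ && X]orbC.
have Froot x : connect F x r.
  elim/(@rtree_ind (RTree pr hp)): x => [|x xr /= IH]; first exact: connect0.
  apply: connect_trans IH; have [->|npx] := eqVneq (p x) x; first exact: connect0.
  by apply: connect1; rewrite /F /= eq_sym npx eqxx.
have Fadj a b : F a b -> adj a b.
  have Hp a' : a' != p a' -> adj a' (p a').
    by move=> n; have /pP /andP [] : a' != r by apply: contraNneq n => ->; rewrite pr.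
  case/andP => nab /orP [] /eqP e; first by rewrite -e Hp ?e.
  by rewrite adj_sym -e Hp // e eq_sym.
have : connect F u v by apply: connect_trans (Froot u) _; rewrite Fsym Froot.
case/connectP => s us vs; case: (shortenP us) vs => s' us' uniq_s' _ vs.
have : size (u :: s') <= 2.
  apply: acy; rewrite /ucycle uniq_s' andbT /= rcons_path (sub_path Fadj) //=.
  by rewrite -vs adj_sym.
(* With at most two vertices, the cycle either has [u = v] or is a single parent edge [uv], and both
   are excluded. *)
case: s' us' vs {uniq_s'} => [|w [|//]] /=; first by move=> _ e; rewrite e adj_irrefl in uv.
by rewrite /F => /andP [/andP [_ H] _] e _; move: H; rewrite -e (negPf nuv) (negPf nvu).
Qed.

(** The root is the first vertex, the parent is the preceding one, and the height is the
    position. *)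
Lemma path_rooting (T : sgraph) : is_path T -> 0 < #|T| ->
  exists (p : T -> T) (r : T) (h : T -> nat), [/\ p r = r,
    forall x, x != r -> h (p x) < h x, forall u v, adj u v -> p u = v \/ p v = u &
    forall x, #|[set c | (c != r) && (p c == x)]| <= 1].
Proof.
move=> [[|n] [f [[g gK fK] f_adj]]] => [/card_gt0P [x _]|_]; first by case: (g x).
have g_gt0 x : x != f ord0 -> 0 < g x.
  move=> xr; rewrite lt0n; apply: contraNneq xr => g0.
  by rewrite -[x]fK; apply/eqP; congr f; exact: val_inj.
exists (fun x => f (inord (g x).-1)), (f ord0), (fun x => g x : nat); split.
- by rewrite gK /=; congr f; apply: val_inj; rewrite /= inordK.
- by move=> x /g_gt0 gx; rewrite gK inord_pred ltn_predL.
- move=> u v; rewrite -{1}[u]fK -{1}[v]fK f_adj => /orP [] /eqP e; [right|left].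
    by rewrite -e /= -[RHS]fK; congr f; rewrite inord_val.
  by rewrite -e /= -[RHS]fK; congr f; rewrite inord_val.
- move=> x; rewrite leqNgt; apply/negP => /card_gt1P [c [c' []]]; rewrite !inE.
  move=> /andP [/g_gt0 c0 /eqP <-] /andP [/g_gt0 c0' /eqP /(can_inj gK) /(congr1 val) /=].
  rewrite !inord_pred => e; apply/negP; rewrite negbK; apply/eqP/(can_inj fK)/val_inj.
  by rewrite /= -(prednK c0) -e prednK.
Qed.

Lemma rdecomp_binary (H T : sgraph) (bag : T -> {set H}) (k : nat) :
  tree_decomposition bag -> (forall t, #|bag t| <= k) ->
  exists (R : rtree) (bag' : R -> {set H}),
    [/\ rdecomp bag', forall x : R, #|children x| <= 2 & forall x, #|bag' x| <= k].
Proof.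
move=> [treeT cov conn edg] bk; have [p [r [h [pr hp padj]]]] := tree_rooting treeT.
pose R := RTree pr hp.
have dec : rdecomp (T := R) bag.
  split=> // v; apply: subtree_connected padj (conn v) _.
  by have [t vt] := cov v; exists t; rewrite inE.
have [n [idx idx_inj]] : exists n, exists idx : R -> 'I_n.+1, injective idx.
  exists #|T|.-1, (fun v => inord (enum_rank v)) => u v /(congr1 val) /=.
  have T_gt0 : 0 < #|T| by case: treeT.
  by rewrite !inordK ?prednK // => /val_inj/enum_rank_inj.
exists (chain idx), (fun x => bag x.1); split=> [|x|x //].
  exact: rdecomp_chain.
exact: chain_children_inj.
Qed.

Lemma rdecomp_unary (H T : sgraph) (bag : T -> {set H}) (k : nat) :
  tree_decomposition bag -> is_path T -> (forall t, #|bag t| <= k) ->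
  exists (R : rtree) (bag' : R -> {set H}),
    [/\ rdecomp bag', forall x : R, #|children x| <= 1 & forall x, #|bag' x| <= k].
Proof.
move=> [[T_gt0 _ _] cov conn edg] pathT bk.
have [p [r [h [pr hp padj p1]]]] := path_rooting pathT T_gt0.
exists (RTree pr hp), bag; split=> //; split=> // v.
apply: subtree_connected padj (conn v) _.
by have [t vt] := cov v; exists t; rewrite inE.
Qed.

(** * From rooted trees back to graphs *)

Definition tree_adj (R : rtree) : rel R :=
  fun x y => (x != y) && ((par x == y) || (par y == x)).

Lemma tree_adj_sym (R : rtree) : symmetric (@tree_adj R).
Proof. by move=> x y; rewrite /tree_adj eq_sym [X in _ && X]orbC. Qed.

Lemma tree_adj_irrefl (R : rtree) : irreflexive (@tree_adj R).
Proof. by move=> x; rewrite /tree_adj eqxx. Qed.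

Definition tree_graph (R : rtree) : sgraph :=
  SGraph (@tree_adj_sym R) (@tree_adj_irrefl R).

Lemma tree_adj_height (R : rtree) (x y : R) :
  tree_adj x y -> height y <= height x -> y = par x.
Proof.
case/andP => nxy /orP [/eqP //|/eqP e]; rewrite -e leqNgt height_par //.
by apply: contraNneq nxy => yr; rewrite -e yr par_root.
Qed.

Lemma connected_subtree (R : rtree) (m : R) (S : {set R}) :
  subtree_at m S -> @connected_in (tree_graph R) S.
Proof.
move=> [mS Sm]; pose e : rel R := fun u v => [&& u \in S, v \in S & tree_adj u v].
have e_sym : connect_sym e.
  apply: sym_connect_sym => x y; rewrite /e /= tree_adj_sym.
  by case: (x \in S); case: (y \in S).
have to_m x : x \in S -> connect e x m.
  elim/rtree_ind: x => [|x xr IH] xS.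
    have [->|/(Sm _ xS) [] ] := eqVneq troot m; first exact: connect0.
    by rewrite eqxx.
  have [->|/(Sm _ xS) [_ pS]] := eqVneq x m; first exact: connect0.
  apply: connect_trans (IH pS); have [->|npx] := eqVneq (par x) x; first exact: connect0.
  by apply: connect1; rewrite /e /= xS pS /tree_adj eq_sym npx eqxx.
move=> x y xS yS; change (is_true (connect e x y)).
by apply: connect_trans (to_m x xS) _; rewrite e_sym to_m.
Qed.

Lemma tree_graph_tree (R : rtree) : is_tree (tree_graph R).
Proof.
split; first by apply/card_gt0P; exists troot.
  have : subtree_at (T := R) troot [set: R] by split=> // x; rewrite !inE.
  exact: connected_subtree.
move=> c /[dup] cyc_c /andP [_ uniq_c]; rewrite leqNgt; apply/negP => c3.
have [x0 x0c] : exists x, x \in c.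
  by case: c c3 {cyc_c uniq_c} => // x c _; exists x; rewrite mem_head.
(* Both cycle neighbours of a node of maximal height are its parent, so the cycle repeats a
   vertex. *)
case: (@arg_maxnP _ x0 (mem c) (@height R) x0c) => x /= xc max_x.
have [i s Es] := rot_to xc.
move: cyc_c c3; rewrite -(rot_ucycle i) -(size_rot i) Es => /andP [cyc uniq_s].
have in_s z : z \in s -> height z <= height x.
  by move=> zs; apply: max_x; rewrite -(mem_rot i) Es inE zs orbT.
case: s => [//|y [//|z s]] in Es cyc uniq_s in_s *.
move: cyc; rewrite /= -/(path _ _ _) rcons_path => /and3P [xy yz /andP [_ lx]] _.
have ey : y = par x by apply: tree_adj_height xy _; rewrite in_s ?mem_head.
have el : last z s = par x.
  by apply: tree_adj_height; [rewrite tree_adj_sym|rewrite in_s // inE mem_last orbT].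
by move: uniq_s; rewrite /= ey -el mem_last andbF.
Qed.

Lemma tree_graph_decomposition (H : sgraph) (R : rtree) (bag : R -> {set H}) :
  rdecomp bag -> @tree_decomposition H (tree_graph R) bag.
Proof.
move=> [sub edg]; split=> [|v|v|//]; first exact: tree_graph_tree.
  by have [m [mS _]] := sub v; exists m; rewrite inE in mS.
by have [m sm] := sub v; exact: connected_subtree sm.
Qed.

(** The distance to the root. Unlike [height], it changes by exactly one along each edge, so it can
    number the vertices of a path. *)
Definition depth {R : rtree} (x : R) : nat := #|[set z | anc z x && (z != x)]|.

Lemma depth_par (R : rtree) (x : R) : x != troot -> depth x = (depth (par x)).+1.
Proof.
move=> xr; rewrite /depth (cardsD1 (par x)) inE anc_par.
have npx : par x != x by apply: contraTneq (height_par xr) => ->; rewrite ltnn.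
rewrite npx add1n; congr _.+1; apply: eq_card => z; rewrite !inE andbC.
have [_|nzp] := eqVneq z (par x); rewrite /= ?andbF // !andbT.
apply/andP/idP => [[zx nzx]|zp]; first exact: anc_parr.
split; first exact: anc_trans zp (anc_par x).
apply: contraNneq npx => zx; rewrite zx in zp.
by apply/eqP; exact: anc_anti (anc_par x) zp.
Qed.

Lemma depth_anc (R : rtree) (x y : R) : anc x y -> x != y -> depth x < depth y.
Proof.
move=> xy nxy; apply: proper_card; apply/properP; split.
  apply/subsetP => z; rewrite !inE => /andP [zx nzx]; rewrite (anc_trans zx xy) /=.
  by apply: contraNneq nzx => zy; rewrite zy in zx *; rewrite (anc_anti zx xy).
by exists x; rewrite !inE ?xy ?nxy // eqxx andbF.
Qed.

(** If the meet differs from both nodes, its only child is a common ancestor below it. *)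
Lemma unary_anc_total (R : rtree) (x y : R) :
  (forall z : R, #|children z| <= 1) -> anc x y || anc y x.
Proof.
move=> R1; have [m /andP [mx my] max_m] := anc_meet x y.
have [<-|nmx] := eqVneq m x; first by rewrite my.
have [<-|nmy] := eqVneq m y; first by rewrite mx orbT.
have [c cm cx] := anc_child mx nmx; have [c' cm' cy] := anc_child my nmy.
have e : c = c'.
  have /card_le1P/(_ _ cm _)/= := R1 m; move=> /(_ c').
  by rewrite cm' inE => /esym/eqP.
by rewrite -e in cy; have := child_anc cm; rewrite max_m.
Qed.

Lemma tree_graph_path (R : rtree) :
  (forall x : R, #|children x| <= 1) -> is_path (tree_graph R).
Proof.
move=> R1; have depth_inj : injective (@depth R).
  move=> x y e; apply/eqP/contraT => nxy.
  case/orP: (unary_anc_total x y R1) => /depth_anc.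
    by rewrite e ltnn => /(_ nxy).
  by rewrite e ltnn eq_sym => /(_ nxy).
have depth_lt (x : R) : depth x < #|R|.
  rewrite -cardsT; apply: proper_card; apply/properP; split; first exact: subsetT.
  by exists x; rewrite !inE // eqxx andbF.
(* An injection between sets of equal size; its inverse [f] enumerates the path. *)
have [f gK fK] : bijective (fun x => Ordinal (depth_lt x)).
  by apply: inj_card_bij => [x y [] /depth_inj //|]; rewrite card_ord.
exists #|R|, f; split; first by exists (fun x => Ordinal (depth_lt x)).
have adj_depth (x y : R) : tree_adj x y = ((depth x).+1 == depth y) || ((depth y).+1 == depth x).
  apply/andP/orP => [[nxy /orP [] /eqP e]|].
  - right; rewrite -e -depth_par //.
    by apply: contraNneq nxy => xr; rewrite -e xr par_root.
  - left; rewrite -e -depth_par //.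
    by apply: contraNneq nxy => yr; rewrite -e yr par_root.
  have par_of (a b : R) : (depth a).+1 = depth b -> (a != b) && (par b == a).
    move=> e; apply/andP; split.
      by apply: contra_eqN e => /eqP ->; rewrite neq_ltn ltnSn orbT.
    have br : b != troot.
      apply: contra_eqN e => /eqP ->; apply/eqP => e.
      have [etr|n] := eqVneq a troot; first by move: e; rewrite etr; lia.
      by have := depth_anc (anc_root a); rewrite eq_sym => /(_ n); lia.
    by apply/eqP/depth_inj; move: e; rewrite (depth_par br) => -[].
  by case=> /eqP/par_of /andP [nab ->]; rewrite ?nab ?orbT // eq_sym nab.
move=> i j; have := adj_depth (f i) (f j); rewrite /= => ->.
by have := congr1 val (fK i); have := congr1 val (fK j) => /= -> ->.
Qed.

(** * The bounds on the widths *)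

Lemma treewidthP (H : sgraph) :
  exists k, [/\ treewidth H = (k%:Z - 1)%R, td_size H k & forall j, td_size H j -> k <= j].
Proof.
rewrite /treewidth; case: ex_minnP => k /asboolP Hk min_k; exists k; split=> // j Hj.
by apply: min_k; apply/asboolP.
Qed.

Lemma pathwidthP (H : sgraph) :
  exists k, [/\ pathwidth H = (k%:Z - 1)%R, pd_size H k & forall j, pd_size H j -> k <= j].
Proof.
rewrite /pathwidth; case: ex_minnP => k /asboolP Hk min_k; exists k; split=> // j Hj.
by apply: min_k; apply/asboolP.
Qed.

Lemma largest_bag_gt0 (H T : sgraph) (bag : T -> {set H}) :
  0 < #|H| -> tree_decomposition bag -> 0 < largest_bag bag.
Proof.
move=> /card_gt0P [v _] [_ /(_ v) [t vt] _ _].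
apply: leq_trans (leq_bigmax (F := fun t => #|bag t|) t).
by apply/card_gt0P; exists v.
Qed.

(** The case [d = 2], halved. Here [k] is a bag size, so [k.-1] stands for the width, and [0 < k]
    keeps the truncated predecessor faithful. *)
Lemma td_size_line (G : sgraph) (k : nat) :
  let D := max_degree G in
  0 < #|G| -> td_size G k ->
  0 < k /\ exists2 s, td_size (line_graph G) s & 3 * s <= 2 * k * D + D + k.-1 ^ 2.
Proof.
move=> D G_gt0 [T [bag [td <-]]]; have k_gt0 := largest_bag_gt0 G_gt0 td.
split=> //; have bk t : #|bag t| <= (largest_bag bag).-1.+1.
  by rewrite prednK //; exact: (leq_bigmax (F := fun t => #|bag t|)).
have [R [bagR [dec R2 Rk]]] := rdecomp_binary td bk.
have [R' [bag' [dec' _ small]]] := line_rdecomp_bounded G_gt0 (isT : 0 < 2) dec R2 Rk.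
exists (@largest_bag (line_graph G) (tree_graph R') bag').
  by exists (tree_graph R'), bag'; split=> //; exact: tree_graph_decomposition.
rewrite mulnC -leq_divRL //; apply/bigmax_leqP => x _; rewrite leq_divRL //.
by have := small x; rewrite prednK //; lia.
Qed.

(** The case [d = 1]. It yields the quadratic term with factor [1/4], of which only [1/2] is
    kept. *)
Lemma pd_size_line (G : sgraph) (k : nat) :
  let D := max_degree G in
  0 < #|G| -> pd_size G k ->
  0 < k /\ exists2 s, pd_size (line_graph G) s & 2 * s <= k * D + D + k.-1 ^ 2.
Proof.
move=> D G_gt0 [T [bag [td pathT <-]]]; have k_gt0 := largest_bag_gt0 G_gt0 td.
split=> //; have bk t : #|bag t| <= (largest_bag bag).-1.+1.
  by rewrite prednK //; exact: (leq_bigmax (F := fun t => #|bag t|)).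
have [R [bagR [dec R1 Rk]]] := rdecomp_unary td pathT bk.
have [R' [bag' [dec' R1' small]]] := line_rdecomp_bounded G_gt0 (isT : 0 < 1) dec R1 Rk.
exists (@largest_bag (line_graph G) (tree_graph R') bag').
  exists (tree_graph R'), bag'; split=> //; first exact: tree_graph_decomposition.
  exact: tree_graph_path.
rewrite mulnC -leq_divRL //; apply/bigmax_leqP => x _; rewrite leq_divRL //.
by have := small x; rewrite prednK //; lia.
Qed.

Local Open Scope ring_scope.

Theorem theorem1p3 (G : sgraph) (G_gt0 : (0 < #|G|)%N) :
  ((treewidth (line_graph G))%:~R : rat)
    <= 2 / 3 * ((treewidth G)%:~R + 1) * (max_degree G)%:R
       + 1 / 3 * (treewidth G)%:~R ^+ 2 + 1 / 3 * (max_degree G)%:R - 1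
  /\
  ((pathwidth (line_graph G))%:~R : rat)
    <= 1 / 2 * ((pathwidth G)%:~R + 1) * (max_degree G)%:R
       + 1 / 2 * (pathwidth G)%:~R ^+ 2 + 1 / 2 * (max_degree G)%:R - 1.
Proof.
split.
- have [k [-> Gk _]] := treewidthP G; have [l [-> _ l_min]] := treewidthP (line_graph G).
  have [k_gt0 [s Ls sk]] := td_size_line G_gt0 Gk.
  (* From here on [k] is the treewidth itself and [k.+1] the bag size. *)
  case: k k_gt0 sk {Gk} => // k _ /= sk.
  have {}sk : (3 * l <= 2 * k.+1 * max_degree G + max_degree G + k ^ 2)%N.
    by rewrite (leq_trans _ sk) // leq_mul2l l_min.
  rewrite !rmorphB /= -!pmulrn; move: sk; rewrite -(ler_nat rat) => sk.
  lra.
- have [k [-> Gk _]] := pathwidthP G; have [l [-> _ l_min]] := pathwidthP (line_graph G).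
  have [k_gt0 [s Ls sk]] := pd_size_line G_gt0 Gk.
  case: k k_gt0 sk {Gk} => // k _ /= sk.
  have {}sk : (2 * l <= k.+1 * max_degree G + max_degree G + k ^ 2)%N.
    by rewrite (leq_trans _ sk) // leq_mul2l l_min.
  rewrite !rmorphB /= -!pmulrn; move: sk; rewrite -(ler_nat rat) => sk.
  lra.
Qed.
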